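(* Let $\mathcal P$ be the finite set of provider records and let $\mathcal C_{\mathrm{elig}}$ be the finite set of eligible bid columns (at most one per provider, so $|\mathcal C_{\mathrm{elig}}|\le|\mathcal P|$), and consider the exhaustive discovery-and-admission loop described in the context. Suppose that every $p\in\mathcal P$ is eventually engaged for its true offered key, so that every genuinely eligible provider passes verification and returns its fixed bid, and that every revealed unadmitted bid persists in the repository. Suppose further that matching gates, the engagement budget, the material-gap stop, any iteration cap of the inner solver and any maximum-round truncation are disabled, and that every restricted exchange problem and one associated shadow price are solved exactly. Then the loop makes at most $|\mathcal C_{\mathrm{elig}}|\le|\mathcal P|$ admissions and terminates after finitely many steps. At termination, with final admitted set $R\subseteq\mathcal C_{\mathrm{elig}}$, there is one exact shadow price $\lambda_R^\star$ of the restricted exchange problem with admitted set $R$ such that $c_e-\lambda_R^{\star\top}a_e\ge 0$ for every excluded column $e\in\mathcal C_{\mathrm{elig}}\setminus R$, and the returned restricted solution (with all excluded columns at zero uptake) is optimal for the exchange problem whose admitted set is all of $\mathcal C_{\mathrm{elig}}$; in particular its value equals the optimal value of that full problem.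
   Context: Exchange problem. Let $\mathcal K$ be a finite set of commodities, and let $\mathcal M^0$ be a finite set of incumbent firms. Agent $0$ (recourse) has cost $\tilde F_0(q)=\Phi(q)$ if $q\in\mathbb R_+^{|\mathcal K|}$ and $+\infty$ otherwise, where $\Phi:\mathbb R_+^{|\mathcal K|}\to\mathbb R$ is finite, closed, convex and componentwise nondecreasing. Each firm $m\in\mathcal M^0$ has a closed, proper, convex cost function $\tilde F_m:\mathbb R^{|\mathcal K|}\to(-\infty,+\infty]$ of its net injection (positive entries supply capacity, negative entries receive it). A bid column $e=(a_e,c_e,\bar x_e)$ consists of an injection vector $a_e\in\mathbb R_+^{|\mathcal K|}$ (whose support contains the key, i.e. commodity, for which the bid's provider was verified), a unit cost $c_e\ge0$ and a finite limit $\bar x_e>0$; as an agent it has cost $$\tilde F_e(q)=\inf_{0\le x\le\bar x_e}\{c_e x: q=a_e x\}$$ ($+\infty$ if no such $x$ exists). For a finite set $R$ of admitted bids, the restricted exchange problem has agent set $\mathcal I=\{0\}\cup\mathcal M^0\cup R$ and is $$Q(R)=\min_{\{q_i\}_{i\in\mathcal I}}\Big\{\sum_{i\in\mathcal I}\tilde F_i(q_i):\ \sum_{i\in\mathcal I}q_i=0\Big\}.$$ Standing regularity assumption (for each agent set that arises): every $\tilde F_i$ is closed, proper and convex, the problem is feasible with finite optimal value, and its Lagrangian $\sum_i\tilde F_i(q_i)+y^\top\sum_i q_i$ admits a saddle point. An exact shadow price for $R$ is $\lambda=-y$ with $y$ an optimal multiplier (the dual component of a saddle point). The reduced cost of a bid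 $e$ at price $\lambda$ is $c_e-\lambda^\top a_e$. Providers. Each provider $p\in\mathcal P$ has at most one offer, fixed in advance. If $p$ is genuinely eligible, engaging it for its true offered key reveals its bid column $e(p)$; otherwise engagement reveals nothing. $\mathcal C_{\mathrm{elig}}$ is the set of columns revealed by eligible providers (columns of different providers are counted as different). An admitted bid supplies $a_e x_e$ at cost $c_e x_e$ for whatever uptake $0\le x_e\le\bar x_e$ the exchange problem selects. Loop. Start with admitted set $R^0=\emptyset$, repository $\mathcal B=\emptyset$ (revealed, unadmitted bids), and all providers unengaged, ordered in a fixed queue. In round $r=0,1,2,\dots$: (1) solve the restricted exchange problem with admitted set $R^r$ exactly and obtain one exact shadow price $\lambda^r$. (2) If some bid in $\mathcal B$ has negative reduced cost at $\lambda^r$, move the one with most negative reduced cost (ties broken by provider identifier) from $\mathcal B$ to the admitted set, forming $R^{r+1}$, and go to round $r+1$. (3) Otherwise, if all providers have been engaged, stop. (4) Otherwise engage unengaged providers one at a time in queue order (each provider is engaged at most once), adding every revealed bid to $\mathcal B$, until a newly revealed bid has negative reduced cost at $\lambda^r$ or the queue is exhausted. If $\mathcal B$ now contains a bid with negative reduced cost at $\lambda^r$, admit one by the rule in (2) and go to round $r+1$; otherwise stop. The loop returns the last admitted set and the exact solution of its restricted exchange problem. *)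

(* Defs.v *)
From HB Require Import structures.
From mathcomp Require Import all_boot all_order all_algebra.
From mathcomp Require Import all_classical all_reals all_analysis.

Set Implicit Arguments.
Unset Strict Implicit.
Unset Printing Implicit Defensive.

Import Order.TTheory GRing.Theory Num.Theory.
Import numFieldNormedType.Exports.

Local Open Scope ring_scope.

Section ExtendedRealFunctions.
Variables (R : realType) (n : nat).
Implicit Types (f : 'rV[R]_n -> \bar R) (q a lam y : 'rV[R]_n).

Definition nonneg_vec q : bool := [forall k, 0 <= q 0 k].

Definition dot y q : R := \sum_(k < n) y 0 k * q 0 k.

Definition closed_fun f : Prop :=
  closed [set z : 'rV[R]_n * R | (f z.1 <= z.2%:E)%E]%classic.

Definition proper_fun f : Prop :=
  (forall q, (-oo < f q)%E) /\ (exists q, (f q < +oo)%E).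

(* Only applied to functions that never take the value -oo; at the endpoints
   of [0, 1] the convention 0 * +oo = 0 makes the inequality trivial. *)
Definition convex_fun f : Prop :=
  forall (q q' : 'rV[R]_n) (t : R), 0 <= t <= 1 ->
    (f (t *: q + (1 - t) *: q')%R <= t%:E * f q + (1 - t)%R%:E * f q')%E.

(* The values of Phi outside the nonnegative orthant are irrelevant. *)
Definition recourse_cost (Phi : 'rV[R]_n -> R) : 'rV[R]_n -> \bar R :=
  fun q => if nonneg_vec q then (Phi q)%:E else +oo%E.

Definition nondecreasing_on_orthant (Phi : 'rV[R]_n -> R) : Prop :=
  forall q q', nonneg_vec q -> (forall k, q 0 k <= q' 0 k) -> Phi q <= Phi q'.

End ExtendedRealFunctions.

Record bid (R : realType) (n : nat) := Bid {
  injection : 'rV[R]_n;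
  unit_cost : R;
  limit : R }.

Record sealed_offer (R : realType) (n : nat) := SealedOffer {
  true_key : 'I_n;
  bid_column : bid R n }.

Section Bids.
Variables (R : realType) (n : nat).
Implicit Types (e : bid R n) (o : sealed_offer R n) (lam q : 'rV[R]_n).

Definition valid_offer o : Prop :=
  let e := bid_column o in
  [/\ nonneg_vec (injection e), 0 < injection e 0 (true_key o),
      0 <= unit_cost e & 0 < limit e].

(* ereal_inf of the empty set is +oo. *)
Definition bid_cost e : 'rV[R]_n -> \bar R := fun q =>
  ereal_inf [set v | exists x : R,
    [/\ 0 <= x <= limit e, q = x *: injection e & v = (unit_cost e * x)%:E]]%classic.

Definition reduced_cost lam e : R := unit_cost e - dot lam (injection e).

Definition null_bid : bid R n := Bid 0 0 0.

End Bids.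

(* The 'I_n are the commodities, M the incumbent firms, P the providers. *)
Record exchange (R : realType) (n : nat) (M P : finType) := Exchange {
  recourse : 'rV[R]_n -> R;
  firm_cost : M -> 'rV[R]_n -> \bar R;
  eligible : pred P;
  offer : P -> option (sealed_offer R n) }.

Section ExchangeProblem.
Variables (R : realType) (n : nat) (M P : finType) (X : exchange R n M P).
Implicit Types (S : {set P}) (p : P) (lam y : 'rV[R]_n).

(* Columns are identified with their providers, so that equal columns of two
   providers remain distinct. *)
Definition C_elig : {set P} := [set p | eligible X p && isSome (offer X p)].

(* The default null_bid is never reached for p \in C_elig. *)
Definition column p : bid R n :=
  if offer X p is Some o then bid_column o else null_bid R n.

(* None is the recourse agent 0, Some (inl m) a firm, Some (inr p) the bid
   of provider p. *)
Definition agent : finType := option (M + P).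

Implicit Types q : agent -> 'rV[R]_n.

Definition agents S : {set agent} :=
  [set i : agent | if i is Some (inr p) then p \in S else true].

Definition agent_cost (i : agent) : 'rV[R]_n -> \bar R :=
  match i with
  | None => recourse_cost (recourse X)
  | Some (inl m) => firm_cost X m
  | Some (inr p) => bid_cost (column p)
  end.

(* The problem with admitted set S only reads an allocation at agents S. *)
Definition net_injection S q : 'rV[R]_n := \sum_(i in agents S) q i.

Definition balanced S q : Prop := net_injection S q = 0.

Definition objective S q : \bar R := (\sum_(i in agents S) agent_cost i (q i))%E.

Definition optimal_value S : \bar R :=
  ereal_inf [set objective S q | q in [set q | balanced S q]]%classic.

Definition optimal_solution S q : Prop :=
  balanced S q /\ forall q', balanced S q' -> (objective S q <= objective S q')%E.

Definition lagrangian S q y : \bar R :=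
  (objective S q + (dot y (net_injection S q))%:E)%E.

Definition saddle_point S q y : Prop :=
  (forall y', (lagrangian S q y' <= lagrangian S q y)%E) /\
  (forall q', (lagrangian S q y <= lagrangian S q' y)%E).

Definition exact_shadow_price S lam : Prop :=
  exists q y, saddle_point S q y /\ lam = - y.

Definition regular S : Prop :=
  [/\ forall i, i \in agents S ->
        [/\ closed_fun (agent_cost i), proper_fun (agent_cost i)
          & convex_fun (agent_cost i)],
      exists q, balanced S q /\ (objective S q < +oo)%E,
      optimal_value S \is a fin_num
    & exists q y, saddle_point S q y].

Definition zero_extension S q : agent -> 'rV[R]_n :=
  fun i => if i \in agents S then q i else 0.

End ExchangeProblem.

Record loop_state (P : Type) := LoopState {
  admissions : seq P;  (* most recent first *)
  repository : seq P;
  unengaged : seq P }.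

Section DiscoveryLoop.
Variables (R : realType) (n : nat) (M : finType).
Variables (d : Order.disp_t) (P : finOrderType d).
(* The order on P is the order of provider identifiers. *)
Variable X : exchange R n M P.
Variable target : P -> 'I_n.  (* the key for which a provider is engaged *)
Variable queue : seq P.
(* In round r with admitted set S, [solve r S] is the computed solution and
   shadow price; it may depend on the round. *)
Variable solve : nat -> {set P} -> (agent M P -> 'rV[R]_n) * 'rV[R]_n.
Implicit Types (S : {set P}) (p : P) (lam : 'rV[R]_n) (B : seq P).
Implicit Types s : loop_state P.

Definition admitted s : {set P} := [set p in admissions s].

Definition engage p : option (bid R n) :=
  if offer X p is Some o then
    if eligible X p && (target p == true_key o) then Some (bid_column o)
    else None
  else None.

Definition provider_cost lam p : R := reduced_cost lam (column X p).

Definition preferred lam p p' : bool :=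
  (provider_cost lam p < provider_cost lam p') ||
  (provider_cost lam p == provider_cost lam p') && (p <= p')%O.

Definition select lam B : option P :=
  [pick p in B | (provider_cost lam p < 0) && all (preferred lam p) B].

Definition admit_bid p s : loop_state P :=
  LoopState (p :: admissions s) (rem p (repository s)) (unengaged s).

(* The new repository and the providers left in the queue. *)
Fixpoint discover lam (u B : seq P) : seq P * seq P :=
  match u with
  | [::] => (B, [::])
  | p :: u' =>
    if engage p is Some e then
      if reduced_cost lam e < 0 then (p :: B, u') else discover lam u' (p :: B)
    else discover lam u' B
  end.

(* One round at price lam; None means that the loop stops. *)
Definition round lam s : option (loop_state P) :=
  if select lam (repository s) is Some p then Some (admit_bid p s)
  else if nilp (unengaged s) then None
  else
    let: (B, u) := discover lam (unengaged s) (repository s) in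
    if select lam B is Some p then Some (admit_bid p (LoopState (admissions s) B u))
    else None.

Definition round_price (r : nat) s : 'rV[R]_n := (solve r (admitted s)).2.

Definition round_solution (r : nat) s : agent M P -> 'rV[R]_n :=
  (solve r (admitted s)).1.

(* The state at the start of round r; None if the loop stopped before. *)
Fixpoint state_at (r : nat) : option (loop_state P) :=
  if r is r'.+1 then
    obind (fun s => round (round_price r' s) s) (state_at r')
  else Some (LoopState [::] [::] queue).

Definition loop_returns S (q : agent M P -> 'rV[R]_n) : Prop :=
  exists r s, [/\ state_at r = Some s, round (round_price r s) s = None,
                  S = admitted s & q = round_solution r s].

End DiscoveryLoop.

(* Main.v *)
Require Import Defs.
From HB Require Import structures.
From mathcomp Require Import all_boot all_order all_algebra.
From mathcomp Require Import all_classical all_reals all_analysis.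
Import Order.TTheory GRing.Theory Num.Theory.
Local Open Scope ring_scope.

(** Weak duality at the shadow price [lam] of the last round: an admissible
uptake [x] of an excluded bid costs [c * x], which is at least [lam . (x * a)]
when its reduced cost is nonnegative.  Hence relaxing the balance constraint at
price [lam] bounds every allocation of the full problem from below by the
restricted optimum, which the zero extension attains.

The loop stops only when no revealed bid has negative reduced cost and the
queue is exhausted, so every eligible bid is then admitted or in the repository.
Each round before the stop admits a new eligible bid, whence termination. *)

(** * Bilinearity and definiteness of the price pairing *)

Section DotProduct.
Context {R : realType} {n : nat}.
Implicit Types y q : 'rV[R]_n.

Lemma dotDr y q q' : dot y (q + q') = dot y q + dot y q'.
Proof. by rewrite /dot -big_split; apply: eq_bigr => k _; rewrite mxE mulrDr. Qed.

Lemma dotZr y (x : R) q : dot y (x *: q) = x * dot y q.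
Proof. by rewrite /dot mulr_sumr; apply: eq_bigr => k _; rewrite mxE mulrCA. Qed.

Lemma dotZl (x : R) y q : dot (x *: y) q = x * dot y q.
Proof. by rewrite /dot mulr_sumr; apply: eq_bigr => k _; rewrite mxE mulrA. Qed.

Lemma dotDl y y' q : dot (y + y') q = dot y q + dot y' q.
Proof. by rewrite /dot -big_split; apply: eq_bigr => k _; rewrite mxE mulrDl. Qed.

Lemma dotNl y q : dot (- y) q = - dot y q.
Proof. by rewrite -scaleN1r dotZl mulN1r. Qed.

Lemma dotNr y q : dot y (- q) = - dot y q.
Proof. by rewrite -scaleN1r dotZr mulN1r. Qed.

Lemma dot0r y : dot y 0 = 0.
Proof. by rewrite -(scale0r (0 : 'rV_n)) dotZr mul0r. Qed.

Lemma dot_sumr y (I : finType) (A : {pred I}) (q : I -> 'rV[R]_n) :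
  dot y (\sum_(i in A) q i) = \sum_(i in A) dot y (q i).
Proof. exact: (big_morph (dot y) (dotDr y) (dot0r y)). Qed.

Lemma dotvv_eq0 q : dot q q <= 0 -> q = 0.
Proof.
move=> le0; apply/rowP => k; rewrite mxE; apply/eqP.
have sq_ge0 j : true -> 0 <= q 0 j * q 0 j by rewrite -expr2 sqr_ge0.
have : dot q q == 0 by rewrite eq_le le0 sumr_ge0.
by rewrite psumr_eq0 // => /allP/(_ k (mem_index_enum k)); rewrite mulf_eq0 orbb.
Qed.

End DotProduct.

(** * Bounds on the cost of a bid *)

Section BidCost.
Context {R : realType} {n : nat}.
Implicit Types (e : bid R n) (lam q : 'rV[R]_n).

Lemma bid_cost_ge0 e q : 0 <= unit_cost e -> (0 <= bid_cost e q)%E.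
Proof.
move=> c_ge0; apply/ereal_infP => _ [x [/andP[x_ge0 _] _ ->]].
by rewrite lee_fin mulr_ge0.
Qed.

Lemma bid_cost0 e : 0 <= unit_cost e -> 0 <= limit e -> bid_cost e 0 = 0%E.
Proof.
move=> c_ge0 l_ge0; apply/eqP; rewrite eq_le bid_cost_ge0 // andbT.
by apply: ereal_inf_lbound; exists 0; rewrite lexx scale0r mulr0.
Qed.

(** The infimum runs over uptakes [x] with [q = x *: injection e]; at each of them the bound is [x]
    times the sign condition. *)
Lemma bid_cost_ge_dot e lam q :
  0 <= reduced_cost lam e -> ((dot lam q)%:E <= bid_cost e q)%E.
Proof.
rewrite subr_ge0 => rc_ge0; apply/ereal_infP => _ [x [/andP[x_ge0 _] -> ->]].
by rewrite lee_fin dotZr mulrC ler_wpM2r.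
Qed.

End BidCost.

(** * Saddle points and weak duality *)

Section ExchangeDuality.
Context {R : realType} {n : nat} {M P : finType} {X : exchange R n M P}.
Implicit Types (S : {set P}) (lam y : 'rV[R]_n) (q : agent M P -> 'rV[R]_n).

Lemma objective_gtNy S q : regular X S -> (-oo < objective X S q)%E.
Proof.
move=> [cost_reg _ _ _]; rewrite ltNye; apply/eqP => /esum_eqNyP[i [_ iS /eqP]].
by have [_ [gtNy _] _] := cost_reg i iS; rewrite -leeNy_eq leNgt gtNy.
Qed.

(** A cost [+oo] at [q] would, by minimality, make the Lagrangian [+oo] at every allocation,
    including one of finite cost. *)
Lemma saddle_point_fin_num S q y :
  regular X S -> saddle_point X S q y -> objective X S q \is a fin_num.
Proof.
move=> reg [_ min_q]; have [_ [q0 [_ q0_fin]] _ _] := reg.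
rewrite fin_numElt objective_gtNy //=.
rewrite ltey; apply/eqP => Ey; have := min_q q0.
rewrite /lagrangian Ey addye // leye_eq => /eqP L_q0.
by have := lte_add_pinfty q0_fin (ltry (dot y (net_injection S q0))); rewrite L_q0.
Qed.

(* Testing the saddle inequality at [y + net_injection S q] bounds the squared
   norm of the imbalance by 0. *)
Lemma saddle_point_balanced S q y :
  regular X S -> saddle_point X S q y -> balanced S q.
Proof.
move=> reg sad; have fin := saddle_point_fin_num S q y reg sad.
have [max_y _] := sad; apply: dotvv_eq0.
have := max_y (y + net_injection S q).
rewrite /lagrangian leeD2lE // lee_fin.
by rewrite dotDl gerDl.
Qed.

(** The primal part of the saddle point need not be [q]. Being balanced, it costs at least as much
    as [q], and its cost is the minimum of the Lagrangian at [- lam]. *)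
Lemma optimal_le_lagrangian S q lam q' :
  regular X S -> optimal_solution X S q -> exact_shadow_price X S lam ->
  (objective X S q <= objective X S q' - (dot lam (net_injection S q'))%:E)%E.
Proof.
move=> reg [_ opt_q] [qs [y [sad ->]]].
have bal := saddle_point_balanced S qs y reg sad; have [_ min_qs] := sad.
rewrite dotNl EFinN oppeK; apply: le_trans (opt_q _ bal) _.
by apply: le_trans (min_qs q'); rewrite /lagrangian bal dot0r adde0.
Qed.

Lemma optimal_solution_value S q :
  optimal_solution X S q -> objective X S q = optimal_value X S.
Proof.
move=> [bal opt_q]; apply/eqP; rewrite eq_le; apply/andP; split.
  by apply/ereal_infP => _ [q' bal' <-]; exact: opt_q.
by apply: ereal_inf_lbound; exists q.
Qed.

(** * Extension to a larger bid set by zero uptake *)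

Section MoreBids.
Variables S C : {set P}.
Hypothesis sub_SC : S \subset C.

(** Generic in the monoid, so as to split both net injections and extended-real costs. *)
Lemma big_agents_sub (T : Type) (idx : T) (op : Monoid.com_law idx)
    (F : agent M P -> T) :
  \big[op/idx]_(i in agents M C) F i =
  op (\big[op/idx]_(i in agents M S) F i)
     (\big[op/idx]_(i in agents M C :\: agents M S) F i).
Proof.
rewrite (big_setID (agents M S)) /=; congr (op _ _); apply: eq_bigl => i.
rewrite !inE; case: i => [[m|p]|] //=; rewrite andb_idl //.
exact: (fintype.subsetP sub_SC).
Qed.

Lemma excluded_agentP i :
  i \in agents M C :\: agents M S -> exists2 p, p \in C :\: S & i = Some (inr p).
Proof.
by rewrite !inE; case: i => [[m|p]|] // H; exists p; rewrite ?inE.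
Qed.

Lemma net_zero_extension q :
  net_injection C (zero_extension S q) = net_injection S q.
Proof.
rewrite /net_injection big_agents_sub /= [Y in _ + Y]big1 ?addr0.
  by apply: eq_bigr => i iS; rewrite /zero_extension iS.
by move=> i; rewrite /zero_extension inE => /andP[/negPf->].
Qed.

(** [0 <= limit] makes uptake 0 available and [0 <= unit_cost] rules out negative costs, so excluded
    bids cost exactly 0. *)
Lemma objective_zero_extension q :
  (forall p, p \in C :\: S ->
     0 <= unit_cost (column X p) /\ 0 <= limit (column X p)) ->
  objective X C (zero_extension S q) = objective X S q.
Proof.
move=> valid; rewrite /objective big_agents_sub /= [Y in (_ + Y)%E]big1 ?adde0.
  by apply: eq_bigr => i iS; rewrite /zero_extension iS.
move=> i /[dup] /excluded_agentP[p pCS ->].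
rewrite /zero_extension inE => /andP[/negPf-> _].
by have [c_ge0 l_ge0] := valid p pCS; rewrite /= bid_cost0.
Qed.

(* Nonnegative reduced costs make [lam] a dual certificate for the larger
   problem: each excluded bid pays at least [dot lam] of what it injects. *)
Lemma optimal_zero_extension q lam :
  regular X S -> optimal_solution X S q -> exact_shadow_price X S lam ->
  (forall p, p \in C :\: S ->
     0 <= unit_cost (column X p) /\ 0 <= limit (column X p)) ->
  (forall p, p \in C :\: S -> 0 <= reduced_cost lam (column X p)) ->
  optimal_solution X C (zero_extension S q).
Proof.
move=> reg opt shadow valid rc_ge0; have [bal _] := opt.
split=> [|q' bal']; first by rewrite /balanced net_zero_extension.
rewrite objective_zero_extension //.
apply: le_trans (optimal_le_lagrangian _ _ _ q' reg opt shadow) _.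
rewrite {2}/objective big_agents_sub /=; apply: leeD => //.
(* Balance over [C] turns the priced imbalance of the agents of [S] into the value at [lam] of the
   excluded injections. *)
move: bal'; rewrite /balanced /net_injection big_agents_sub /= => /eqP.
rewrite addr_eq0 => /eqP->; rewrite dotNr opprK dot_sumr -sumEFin.
apply: lee_sum => i /excluded_agentP[p pCS ->] /=.
exact: bid_cost_ge_dot (rc_ge0 p pCS).
Qed.

End MoreBids.
End ExchangeDuality.

(** * Choice of the bid to admit *)

Section DiscoveryLoop.
Context {R : realType} {n : nat} {M : finType}.
Context {d : Order.disp_t} {P : finOrderType d}.
Context {X : exchange R n M P} {target : P -> 'I_n}.
Implicit Types (lam : 'rV[R]_n) (p : P) (B u : seq P) (s : loop_state P).

Let pref_total lam : total (preferred X lam).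
Proof.
move=> p p'; rewrite /preferred (eq_sym (provider_cost X lam p')).
by case: ltgtP => //= _; exact: le_total.
Qed.

Let pref_trans lam : transitive (preferred X lam).
Proof.
move=> p2 p1 p3; rewrite /preferred.
case/orP=> [lt12|/andP[/eqP-> le12]].
  by case/orP=> [/(lt_trans lt12)->//|/andP[/eqP<- _]]; rewrite lt12.
by case/orP=> [->//|/andP[-> /(le_trans le12)->]]; rewrite orbT.
Qed.

Lemma selectP lam B p :
  select X lam B = Some p -> p \in B /\ provider_cost X lam p < 0.
Proof. by rewrite /select; case: pickP => // p0 /and3P[p0B p0_lt0 _] [<-]. Qed.

(** A priori [select] could also fail because no bid is preferred to all others. Sorting by the
    lexicographic order [preferred] excludes this: the head is preferred, and its reduced cost is
    negative as soon as that of some bid is. *)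
Lemma select_none lam B p :
  select X lam B = None -> p \in B -> 0 <= provider_cost X lam p.
Proof.
rewrite /select; case: pickP => // none _ pB; rewrite leNgt; apply/negP => p_lt0.
case sortB: (sort (preferred X lam) B) => [|p0 B'].
  by move: pB; rewrite -(mem_sort (preferred X lam)) sortB.
have := sort_sorted (pref_total lam) B; rewrite sortB /=.
move=> /(order_path_min (pref_trans lam)) min_p0.
have pref_p0 : all (preferred X lam p0) B.
  rewrite -(all_sort _ (preferred X lam)) sortB /= min_p0 andbT.
  by have /orP[] := pref_total lam p0 p0.
have := none p0; rewrite -(mem_sort (preferred X lam)) sortB mem_head pref_p0 /=
  andbT.
have /orP[/lt_trans/(_ p_lt0)->//|/andP[/eqP-> _]] := allP pref_p0 p pB.
by rewrite p_lt0.
Qed.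

(** * Loop invariant and termination *)

Section TrueKeys.
Hypothesis true_keys : forall p o, offer X p = Some o -> target p = true_key o.

Lemma engageE p :
  engage X target p = if p \in C_elig X then Some (column X p) else None.
Proof.
rewrite /engage /column inE; case offer_p: (offer X p) => [so|]; rewrite ?andbF //.
by rewrite (true_keys _ _ offer_p) eqxx.
Qed.

(** The first two clauses bound the number of admissions; the third places every unadmitted eligible
    bid in the repository once the queue is empty. *)
Definition loop_invariant s : Prop :=
  [/\ uniq (admissions s ++ repository s ++ unengaged s),
      {subset admissions s ++ repository s <= C_elig X}
    & {subset C_elig X <= admissions s ++ repository s ++ unengaged s}].

(** An engaged provider moves from queue to repository or, lying outside [C_elig X], is dropped
    without harm to coverage. *)
Lemma discover_invariant lam A B u B' u' :
  discover X target lam u B = (B', u') ->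
  loop_invariant (LoopState A B u) -> loop_invariant (LoopState A B' u').
Proof.
elim: u B => [|p u IHu] B /=; first by case=> <- <-.
have perm_swap : perm_eq (A ++ B ++ p :: u) (A ++ (p :: B) ++ u).
  by rewrite perm_cat2l perm_catC /= perm_cons perm_catC.
rewrite engageE; have [pC|pNC] := ifPn.
  (* Both outcomes of the price test add [p] to the repository, so one transfer serves both. *)
  suff step : loop_invariant (LoopState A B (p :: u)) ->
              loop_invariant (LoopState A (p :: B) u).
    by case: ifP => _; [case=> <- <- | move=> /IHu step' /step].
  case=> /= uniqA subC coverC; split=> /=.
  - by rewrite -(perm_uniq perm_swap).
  - move=> p'; rewrite mem_cat inE orbCA => /predU1P[->//|p'AB].
    by apply: subC; rewrite mem_cat.
  - by move=> p' /coverC; rewrite (perm_mem perm_swap).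
move=> /IHu step [/= uniqA subC coverC]; apply: step; split=> //=.
- by move: uniqA; rewrite (perm_uniq perm_swap) /= -cat1s uniq_catCA => /andP[].
- move=> p' p'C; have := coverC p' p'C.
  rewrite (perm_mem perm_swap) !mem_cat inE.
  by case: eqP => // p'E; rewrite -p'E p'C in pNC.
Qed.

(** Discovery can leave providers in the queue only after putting a bid of negative reduced cost
    into [B']. *)
Lemma discover_exhaustive lam u B B' u' :
  discover X target lam u B = (B', u') ->
  (forall p, p \in B' -> 0 <= provider_cost X lam p) -> u' = [::].
Proof.
elim: u B => [|p u IHu] B /=; first by case.
rewrite engageE; case: ifP => _; last exact: IHu.
case: ifP => [rc_lt0 [<- _] /(_ p)|_]; last exact: IHu.
by rewrite mem_head leNgt /provider_cost rc_lt0 => /(_ isT).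
Qed.

Lemma admit_invariant p s :
  p \in repository s -> loop_invariant s -> loop_invariant (admit_bid p s).
Proof.
case: s => A B u /= pB [/= uniqA subC coverC].
have perm_swap : perm_eq (A ++ B) ((p :: A) ++ rem p B).
  rewrite (perm_catl _ (perm_to_rem pB)) /= -cat1s.
  by rewrite perm_sym -cat_cons -cat1s -catA perm_catCA.
have perm_swap3 : perm_eq (A ++ B ++ u) ((p :: A) ++ rem p B ++ u).
  by rewrite !catA perm_cat2r.
split=> [|p'|p' /coverC].
- by rewrite -(perm_uniq perm_swap3).
- by rewrite -(perm_mem perm_swap); exact: subC.
- by rewrite (perm_mem perm_swap3).
Qed.

Lemma round_some lam s s' :
  round X target lam s = Some s' -> loop_invariant s ->
  loop_invariant s' /\ size (admissions s') = (size (admissions s)).+1.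
Proof.
rewrite /round; case sel: select => [p|].
  move=> [<-] inv; have [pB _] := selectP _ _ _ sel.
  by split=> //; exact: admit_invariant.
case: nilp => //; case disc: discover => [B u].
case sel': select => [p|] // [<-] inv; have [pB _] := selectP _ _ _ sel'.
split=> //; apply: admit_invariant => //.
by apply: discover_invariant disc _; case: (s) inv.
Qed.

Lemma round_none lam s p :
  round X target lam s = None -> loop_invariant s ->
  p \in C_elig X :\: admitted s -> 0 <= provider_cost X lam p.
Proof.
case: s => A B u; rewrite /round /= finset.in_setD => + inv /andP[pNA pC].
rewrite inE /= in pNA; case sel: select => [//|].
case: nilP => [u0|_].
  move=> _; apply: select_none sel _.
  by case: inv => _ _ /(_ p pC) /=; rewrite u0 cats0 mem_cat (negPf pNA).
case disc: discover => [B' u']; case sel': select => [//|] _.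
have B'_ge0 p' := select_none _ _ p' sel'.
have u'0 := discover_exhaustive _ _ _ _ _ disc B'_ge0.
(* The stopping round does not store [B'], so coverage is read off the intermediate state after
   discovery. *)
apply: B'_ge0; have [_ _ /(_ p pC)] := discover_invariant _ _ _ _ _ _ disc inv.
by rewrite /= u'0 cats0 mem_cat (negPf pNA).
Qed.

Lemma invariant_admitted_sub s :
  loop_invariant s -> admitted s \subset C_elig X.
Proof.
move=> [_ subC _]; apply/fintype.subsetP => p; rewrite inE => pA.
by apply: subC; rewrite mem_cat pA.
Qed.

Lemma invariant_size s :
  loop_invariant s -> (size (admissions s) <= #|C_elig X|)%N.
Proof.
move=> inv; have [uniqA _ _] := inv.
have /card_uniqP <- : uniq (admissions s).
  by move: uniqA; rewrite cat_uniq => /and3P[].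
apply: leq_trans (subset_leq_card (invariant_admitted_sub _ inv)).
by rewrite cardsE.
Qed.

Context {queue : seq P}.
Context {solve : nat -> {set P} -> (agent M P -> 'rV[R]_n) * 'rV[R]_n}.
Hypotheses (queue_uniq : uniq queue) (queue_all : forall p, p \in queue).

(** Each continued round admits exactly one bid, so bounding admissions also bounds rounds. *)
Lemma state_at_invariant r s :
  state_at X target queue solve r = Some s ->
  loop_invariant s /\ size (admissions s) = r.
Proof.
elim: r s => [|r IHr] s /=; first by case=> <-; split=> //; split.
case state_r: state_at => [s'|] //= /round_some step.
by have [inv <-] := IHr _ state_r; exact: step.
Qed.

Lemma loop_terminates : exists S q, loop_returns X target queue solve S q.
Proof.
have stops : exists r, ~~ isSome (state_at X target queue solve r).
  exists #|C_elig X|.+1; case state_r: state_at => [s|//].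
  have [/invariant_size + size_s] := state_at_invariant _ _ state_r.
  by rewrite size_s ltnn.
(* Round 0 has a state, so the least undefined round is a successor, and the loop stops in the round
   before it. *)
case: (ex_minnP stops) => -[|r] //= + first_stop.
case state_r: (state_at _ _ _ _ r) => [s|] /=; last first.
  by have := first_stop r; rewrite state_r ltnn => /(_ isT).
case stop: round => [//|] _.
by exists (admitted s), (round_solution solve r s), r, s.
Qed.

End TrueKeys.
End DiscoveryLoop.

Theorem proposition4p3 (R : realType) (n : nat) (M : finType)
    (d : Order.disp_t) (P : finOrderType d) (X : exchange R n M P)
    (target : P -> 'I_n) (queue : seq P)
    (solve : nat -> {set P} -> (agent M P -> 'rV[R]_n) * 'rV[R]_n)
    (recourse_closed : closed_fun (recourse_cost (recourse X)))
    (recourse_convex : convex_fun (recourse_cost (recourse X)))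
    (recourse_monotone : nondecreasing_on_orthant (recourse X))
    (firms_regular : forall m : M,
       [/\ closed_fun (firm_cost X m), proper_fun (firm_cost X m)
         & convex_fun (firm_cost X m)])
    (offers_valid : forall p o, offer X p = Some o -> valid_offer o)
    (* the queue lists every provider exactly once *)
    (queue_uniq : uniq queue)
    (queue_all : forall p : P, p \in queue)
    (engaged_for_true_key :
       forall p o, offer X p = Some o -> target p = true_key o)
    (regularity_restricted : forall r s,
       state_at X target queue solve r = Some s -> regular X (admitted s))
    (regularity_full : regular X (C_elig X))
    (exact_solves : forall r s, state_at X target queue solve r = Some s ->
       optimal_solution X (admitted s) (round_solution solve r s) /\
       exact_shadow_price X (admitted s) (round_price solve r s)) :
  [/\ (#|C_elig X| <= #|P|)%N,
      forall r s, state_at X target queue solve r = Some s ->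
        (size (admissions s) <= #|C_elig X|)%N,
      exists S q, loop_returns X target queue solve S q
    & forall S q, loop_returns X target queue solve S q ->
        [/\ S \subset C_elig X,
            exists lam, exact_shadow_price X S lam /\
              forall p, p \in C_elig X :\: S ->
                0 <= reduced_cost lam (column X p),
            optimal_solution X (C_elig X) (zero_extension S q)
          & objective X S q = optimal_value X (C_elig X) /\
            objective X (C_elig X) (zero_extension S q)
              = optimal_value X (C_elig X)]].
Proof.
have solved r s (state_r : state_at X target queue solve r = Some s) :=
  state_at_invariant engaged_for_true_key queue_uniq queue_all _ _ state_r.
split.
- exact: max_card.
- by move=> r s /solved[/invariant_size].
- exact (loop_terminates (solve := solve) engaged_for_true_key queue_uniq queue_all).
move=> _ _ [r [s [state_r stop -> ->]]].
have [inv _] := solved _ _ state_r.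
have subC := invariant_admitted_sub _ inv.
have [opt shadow] := exact_solves _ _ state_r.
have rc_ge0 p := round_none engaged_for_true_key _ _ p stop inv.
have valid p : p \in C_elig X :\: admitted s ->
    0 <= unit_cost (column X p) /\ 0 <= limit (column X p).
  rewrite !inE /column => /and3P[_ _]; case offer_p: (offer X p) => [so|] // _.
  by have [_ _ ? /ltW] := offers_valid _ _ offer_p.
have opt0 := optimal_zero_extension _ _ subC _ _
  (regularity_restricted _ _ state_r) opt shadow valid rc_ge0.
have value0 := optimal_solution_value _ _ opt0.
(* The certifying price is the one computed in the stopping round itself. *)
split=> //; first by exists (round_price solve r s).
by rewrite -value0 objective_zero_extension.
Qed.
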